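(* Let $j$ be an integer, put $a=\alpha+j$, and let $$P_n^{(j)}(z)=\frac{(-a)_n}{(a+1)_n}\,\frac{an+\beta+n}{an+\beta}\;{}_3F_2\left({-n,\ a+1,\ -(a+1)n-\beta+1\atop a+1-n,\ -(a+1)n-\beta};z\right),\qquad n\ge0$$ (the monic Laurent biorthogonal polynomials with moments $c_k=\frac{k+\beta+a}{\beta(k+a)}$, $k\in\mathbb Z$). Then there are linear differential operators $L_0,L_1,L_2$ in $z$ with polynomial coefficients, not depending on $n$, of orders $4$, $3$, $2$ respectively, such that $P_n^{(j)}$ satisfies the quadratic operator pencil equation $$\bigl(n^2L_2+nL_1+L_0\bigr)P_n^{(j)}(z)=0,\qquad n=0,1,2,\dots.$$ Explicitly, $n^2L_2+nL_1+L_0$ is the operator obtained by replacing $a$ by $a-n$ in $L-\lambda_n$, where $$L=(z(1-z))^2\partial_z^4+z(1-z)(\xi_1z+\xi_0)\partial_z^3+(1-z)(\eta_1z+\eta_0)\partial_z^2+(\zeta_1z+\zeta_0)\partial_z,$$ $$\xi_1=-2(a+4),\quad \xi_0=2(a+2),\quad \eta_1=-(a+2)(a+7)-2\beta,\quad \eta_0=(a+1)(a+2),$$ $$\zeta_1=2(a+2)(a+\beta+1),\quad \zeta_0=-2(a+1)(a+\beta+2),$$ $$\lambda_n=n(n-1)(n-2)(n-3)-\xi_1n(n-1)(n-2)-\eta_1n(n-1)+\zeta_1n.$$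
   Context: ${}_3F_2$ is the ordinary hypergeometric series (terminating here, summed over $0\le s\le n$) and $(x)_n=x(x+1)\cdots(x+n-1)$ is the Pochhammer symbol. Parameters: $\alpha\in\mathbb C\setminus\mathbb Z$, $\beta\in\mathbb C\setminus\{0\}$, with $\beta+na\ne0$ and $\beta+n(a+1)\ne0$ for all integers $n\ge1$. Here the replacement $a\to a-n$ is made in all coefficients $\xi_i,\eta_i,\zeta_i$, including those occurring in $\lambda_n$.
   Formalization: When -(a+1)n-β is one of -1,…,-(n-1), which the assumptions allow, the displayed 3F2 contains terms 0/0; there the quotient of Pochhammer symbols (x+1)_s/(x)_s with x=-(a+1)n-β is read in cancelled form as (x+s)/x, which agrees with the series wherever it is defined. *)

(* Defs.v *)
From HB Require Import structures.
From mathcomp Require Import all_boot all_order all_algebra.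
From mathcomp Require Export reals complex.
From mathcomp Require Import ring.

Set Implicit Arguments.
Unset Strict Implicit.
Unset Printing Implicit Defensive.

Import GRing.Theory Num.Theory.
Local Open Scope ring_scope.

Section Defs.
Variable C : numFieldType.

Definition poch (x : C) (n : nat) : C := \prod_(i < n) (x + i%:R).

(* Partial sum over 0 <= s <= n of 3F2(u1, u2, u3; l1, l2; z), as a polynomial
   in z. *)
Definition hyp3F2 (n : nat) (u1 u2 u3 l1 l2 : C) : {poly C} :=
  \poly_(s < n.+1) (poch u1 s * poch u2 s * poch u3 s /
                    (poch l1 s * poch l2 s * (s`!)%:R)).

(* The series 3F2(-n, a+1, x+1; a+1-n, x; z) with (x+1)_s / (x)_s written as
   (x+s)/x.  The nonvanishing conditions on the parameters only give x != 0, so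
   x may be one of -1, ..., -(n-1); the literal quotient is then 0/0 for
   s > -x, and (x+s)/x is its continuous extension in x.  See hyp3F2_contigE. *)
Definition hyp3F2_contig (n : nat) (a x : C) : {poly C} :=
  \poly_(s < n.+1) (poch (- n%:R) s * poch (a + 1) s /
                    (poch (a + 1 - n%:R) s * (s`!)%:R) * ((x + s%:R) / x)).

Lemma poch_contig (x : C) (s : nat) : poch (x + 1) s * x = poch x s * (x + s%:R).
Proof.
elim: s => [|s IHs]; first by rewrite /poch !big_ord0 addr0 !mul1r.
rewrite {1}/poch big_ord_recr /= -/(poch _ _).
rewrite {2}/poch big_ord_recr /= -/(poch _ _).
by rewrite mulrAC IHs -natr1; ring.
Qed.

Lemma hyp3F2_contigE (n : nat) (a x : C) : x != 0 -> poch x n != 0 ->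
  hyp3F2_contig n a x = hyp3F2 n (- n%:R) (a + 1) (x + 1) (a + 1 - n%:R) x.
Proof.
move=> x0 xn0; apply/polyP => s; rewrite !coef_poly; case: ltnP => // lesn.
have xs0 : poch x s != 0.
  apply/prodf_neq0 => i _; move/prodf_neq0: xn0.
  by move=> /(_ (Ordinal (leq_trans (ltn_ord i) lesn)) isT).
have -> : (x + s%:R) / x = poch (x + 1) s / poch x s.
  by apply/eqP; rewrite eqr_div // poch_contig mulrC.
rewrite mulf_div; congr (_ / _); exact: mulrAC.
Qed.

Definition lbp (a beta : C) (n : nat) : {poly C} :=
  (poch (- a) n / poch (a + 1) n *
     ((a * n%:R + beta + n%:R) / (a * n%:R + beta))) *:
  hyp3F2_contig n a (- ((a + 1) * n%:R) - beta).

Definition lbp_moment (a beta : C) (k : int) : C :=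
  (k%:~R + beta + a) / (beta * (k%:~R + a)).

(* The value at z^m p(z) of the linear functional on Laurent polynomials that
   sends z^k to c k. *)
Definition moment_functional (c : int -> C) (p : {poly C}) (m : int) : C :=
  \sum_(s < size p) p`_s * c (s%:Z + m).

Definition monic_LBP (c : int -> C) (P : nat -> {poly C}) : Prop :=
  forall n : nat,
    [/\ P n \is monic, size (P n) = n.+1,
        forall k : nat, (k < n)%N -> moment_functional c (P n) (- k%:Z) = 0
      & moment_functional c (P n) (- n%:Z) != 0].

(* The operator sum_k D_k(z) d^k/dz^k is encoded by the polynomial D with
   coefficients D_k; only the left {poly C}-module structure of
   {poly {poly C}} is meaningful here, not its commutative product. *)
Definition dz (k : nat) : {poly {poly C}} := 'X^k.

Definition diffop_apply (D : {poly {poly C}}) (p : {poly C}) : {poly C} :=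
  \sum_(k < size D) D`_k * p^`(k).

Definition diffop_order (D : {poly {poly C}}) (d : nat) : Prop := size D = d.+1.

Definition xi1 (a : C) : C := - (2 * (a + 4)).
Definition xi0 (a : C) : C := 2 * (a + 2).
Definition eta1 (a beta : C) : C := - ((a + 2) * (a + 7)) - 2 * beta.
Definition eta0 (a : C) : C := (a + 1) * (a + 2).
Definition zeta1 (a beta : C) : C := 2 * (a + 2) * (a + beta + 1).
Definition zeta0 (a beta : C) : C := - (2 * (a + 1) * (a + beta + 2)).

Definition Lop (a beta : C) : {poly {poly C}} :=
  let z : {poly C} := 'X in
  (z * (1 - z)) ^+ 2 *: dz 4
  + (z * (1 - z) * ((xi1 a)%:P * z + (xi0 a)%:P)) *: dz 3
  + ((1 - z) * ((eta1 a beta)%:P * z + (eta0 a)%:P)) *: dz 2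
  + ((zeta1 a beta)%:P * z + (zeta0 a beta)%:P) *: dz 1.

Definition lambda (a beta : C) (n : nat) : C :=
  let m : C := n%:R in
  m * (m - 1) * (m - 2) * (m - 3) - xi1 a * (m * (m - 1) * (m - 2))
  - eta1 a beta * (m * (m - 1)) + zeta1 a beta * m.

Definition eigen_op (a beta : C) (n : nat) : {poly {poly C}} :=
  Lop a beta - (lambda a beta n)%:P *: dz 0.

End Defs.

(* Main.v *)
Require Import Defs.
From mathcomp Require Import all_boot all_order all_algebra.
From mathcomp Require Import ring.
Import GRing.Theory Num.Theory.
Local Open Scope ring_scope.

(** Put x := - (a + 1) n - beta and w := a + 1 - n.  Up to a factor independent
    of s, the coefficient of z^s in [lbp a beta n] is
    (-1)^s binom(n, s) (w + s)_n (x + s), while the moment c_(s-k) is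
    (1 + beta / (s + a - k)) / beta.  Hence every value of the moment functional
    is an n-th finite difference; splitting x + s as (s + a - k) + (x - a + k)
    leaves the difference of a combination of (y)_(n+1) and (y)_n, which
    vanishes because of the choice of x, and that of g(y) / y for a polynomial g
    of degree n, which is a multiple of g(0) = (1 + k - n)_n.

    At the coefficient of z^m, the differential equation is a three-term
    recurrence; it combines two instances of the first-order recurrence of the
    coefficients of 2F1(-n, a + 1; a + 1 - n; z). *)

Section LaurentBiorthogonal.

Set Implicit Arguments.
Unset Strict Implicit.

Variable C : numFieldType.
Implicit Types (f g : C -> C) (x y a beta : C) (n : nat).

(** * Pochhammer symbols *)

Lemma pochS x s : poch x s.+1 = poch x s * (x + s%:R).
Proof. by rewrite /poch big_ord_recr. Qed.

Lemma pochD x m k : poch x (m + k) = poch x m * poch (x + m%:R) k.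
Proof.
elim: k => [|k IHk]; first by rewrite addn0 /poch big_ord0 mulr1.
by rewrite addnS !pochS IHk natrD; ring.
Qed.

Lemma pochSl x n : poch x n.+1 = x * poch (x + 1) n.
Proof. by rewrite -add1n pochD {1}/poch big_ord1 addr0. Qed.

Lemma poch_neq0 x n : (forall m : int, x != m%:~R) -> poch x n != 0.
Proof.
move=> xZ; apply/prodf_neq0 => i _.
by rewrite addr_eq0 -[_%:R]/((i : nat)%:~R) -mulrNz xZ.
Qed.

Lemma poch_opp_nat n s : poch (- n%:R : C) s = (-1) ^+ s * (n ^_ s)%:R.
Proof.
elim: s => [|s IHs]; first by rewrite /poch big_ord0 mul1r.
rewrite pochS IHs ffactnSr natrM exprS.
have [lesn|ltns] := leqP s n; first by rewrite natrB //; ring.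
by rewrite ffact_small // !(mulr0, mul0r).
Qed.

(** * Coefficients of operators applied to polynomials *)

Lemma size_Lop a beta : (size (Lop a beta) <= 5)%N.
Proof.
apply/leq_sizeP => k le5k; rewrite /Lop /dz !(coefD, coefZ, coefXn).
by rewrite !gtn_eqF ?mulr0 ?addr0 // (leq_trans _ le5k).
Qed.

Lemma diffop_applyE d (D : {poly {poly C}}) p : (size D <= d)%N ->
  diffop_apply D p = \sum_(k < d) D`_k * p^`(k).
Proof.
move=> leD; rewrite /diffop_apply.
rewrite (big_ord_widen d (fun k => D`_k * p^`(k))) // big_mkcond.
apply: eq_bigr => k _; case: ltnP => // leDk.
by rewrite nth_default // mul0r.
Qed.

Lemma natr_ffact s k : (s ^_ k)%:R = \prod_(i < k) (s%:R - i%:R) :> C.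
Proof.
elim: k => [|k IHk]; first by rewrite big_ord0.
rewrite ffactnSr natrM big_ord_recr -IHk /=.
have [leks|ltsk] := leqP k s; first by rewrite natrB.
by rewrite ffact_small // !mul0r.
Qed.

(** The falling factorial is a product in [C], hence polynomial in m and open to [ring]; for m < i
    it contains a zero factor. *)
Lemma coef_CXnM_derivn (c : C) (p : {poly C}) i k m : (i <= k)%N ->
  (c%:P * ('X^i * p^`(k)))`_m =
  c * (p`_(m + (k - i)) * \prod_(l < k) ((m + (k - i))%:R - l%:R)).
Proof.
move=> leik; rewrite coefCM coefXnM coef_derivn -natr_ffact mulr_natr.
congr (_ * _); case: ltnP => [ltmi|leim].
  by rewrite ffact_small // -[ltnRHS](subnKC leik) ltn_add2r.
by have -> : (k + (m - i) = m + (k - i))%N by rewrite !addnBA // addnC.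
Qed.

(* Coefficients of 1, n and n^2 in [eigen_op (a - n%:R) beta n]; the terms in n^3
   and n^4 of [lambda (a - n%:R) beta n] cancel. *)
Definition pencil0 a beta : {poly {poly C}} := Lop a beta.

Definition pencil1 a beta : {poly {poly C}} :=
  let z : {poly C} := 'X in
  - (2 * z * (1 - z) ^+ 2) *: dz _ 3
  + ((1 - z) * ((2 * a + 9)%:P * z - (2 * a + 3)%:P)) *: dz _ 2
  + ((2 * (2 * a + beta + 3))%:P * (1 - z)) *: dz _ 1
  - ((a + 1) * (a + 2 * beta))%:P *: dz _ 0.

Definition pencil2 a : {poly {poly C}} :=
  let z : {poly C} := 'X in
  ((1 - z) ^+ 2) *: dz _ 2 - (2 * (1 - z)) *: dz _ 1
  - (a * (a + 1))%:P *: dz _ 0.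

Lemma eigen_op_pencil a beta n :
  pencil2 a *+ (n ^ 2)%N + pencil1 a beta *+ n + pencil0 a beta
  = eigen_op (a - n%:R) beta n.
Proof.
rewrite /eigen_op /pencil0 /pencil1 /pencil2 /Lop /lambda.
(* Scalings become products by constants, so that [ring] can use the commutative structure of
   [{poly {poly C}}]. *)
rewrite /xi1 /xi0 /eta1 /eta0 /zeta1 /zeta0 -!mul_polyC.
rewrite -[_ *+ (n ^ 2)]mulr_natr -[_ *+ n]mulr_natr natrX /=.
ring.
Qed.

Lemma size_eigen_op a beta n : (size (eigen_op a beta n) <= 5)%N.
Proof.
rewrite (leq_trans (size_polyD _ _)) // geq_max size_Lop size_polyN /=.
by rewrite (leq_trans (size_scale_leq _ _)) // size_polyXn.
Qed.

(** Every monomial z^i d^k/dz^k of the operator has k - i in {0, 1, 2}, so only three coefficients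
    of p contribute. *)
Lemma coef_eigen_op_apply a beta n (p : {poly C}) m :
  (diffop_apply (eigen_op a beta n) p)`_m =
  (m.+2)%:R * (m.+1)%:R * (a + m.+1%:R) * (a + m.+2%:R) * p`_m.+2
  + (- 2 * (m.+1%:R * m%:R * (m%:R - 1) * (m%:R - 2))
     + (xi1 a - xi0 a) * (m.+1%:R * m%:R * (m%:R - 1))
     + (eta1 a beta - eta0 a) * (m.+1%:R * m%:R)
     + zeta0 a beta * m.+1%:R) * p`_m.+1
  + (m%:R * (m%:R - 1) * (m%:R - 2) * (m%:R - 3)
     - xi1 a * (m%:R * (m%:R - 1) * (m%:R - 2))
     - eta1 a beta * (m%:R * (m%:R - 1))
     + zeta1 a beta * m%:R - lambda a beta n) * p`_m.
Proof.
rewrite (@diffop_applyE 5) ?size_eigen_op //.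
rewrite !big_ord_recr big_ord0 /= add0r /eigen_op /Lop /dz.
rewrite !(coefB, coefD, coefZ, coefXn) /=.
rewrite !(mulr1, mulr0, addr0, add0r, subr0, sub0r).
set x1 := xi1 a; set x0 := xi0 a; set h1 := eta1 a beta; set h0 := eta0 a.
set z1 := zeta1 a beta; set z0 := zeta0 a beta; set l := lambda a beta n.
transitivity (((- l)%:P * ('X^0 * p^`(0))
  + (z1%:P * ('X^1 * p^`(1)) + z0%:P * ('X^0 * p^`(1)))
  + ((- h1)%:P * ('X^2 * p^`(2)) + (h1 - h0)%:P * ('X^1 * p^`(2))
     + h0%:P * ('X^0 * p^`(2)))
  + ((- x1)%:P * ('X^3 * p^`(3)) + (x1 - x0)%:P * ('X^2 * p^`(3))
     + x0%:P * ('X^1 * p^`(3)))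
  + (1%:P * ('X^4 * p^`(4)) - 2%:P * ('X^3 * p^`(4)) + 1%:P * ('X^2 * p^`(4))))`_m).
  rewrite -!coefD; apply: (congr1 (fun q : {poly C} => q`_m)).
  by rewrite /derivn /=; ring.
rewrite !(coefB, coefD) !coef_CXnM_derivn //.
rewrite !big_ord_recr !big_ord0 /= addn0 addn1 addn2.
rewrite -!natr1 /x0 /h0 /xi0 /eta0.
ring.
Qed.

(** * Finite differences *)

(* (-1)^n times the usual n-th forward difference. *)
Definition fdiff n f y : C :=
  \sum_(s < n.+1) (-1) ^+ s * 'C(n, s)%:R * f (y + s%:R).

Lemma eq_fdiff n f g y :
  (forall s, (s <= n)%N -> f (y + s%:R) = g (y + s%:R)) ->
  fdiff n f y = fdiff n g y.
Proof. by move=> fg; apply: eq_bigr => s _; rewrite fg // -ltnS. Qed.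

Lemma fdiffD n f g y : fdiff n (fun t => f t + g t) y = fdiff n f y + fdiff n g y.
Proof. by rewrite -big_split; apply: eq_bigr => s _; rewrite mulrDr. Qed.

Lemma fdiffZ n c f y : fdiff n (fun t => c * f t) y = c * fdiff n f y.
Proof. by rewrite big_distrr; apply: eq_bigr => s _; rewrite mulrCA. Qed.

Lemma fdiff_shift n f y : fdiff n (fun t => f (t + 1)) y = fdiff n f (y + 1).
Proof. by apply: eq_bigr => s _; rewrite addrAC. Qed.

Lemma fdiffS n f y : fdiff n.+1 f y = fdiff n f y - fdiff n f (y + 1).
Proof.
have -> : fdiff n f y =
    \sum_(s < n.+2) (-1) ^+ s * 'C(n, s)%:R * f (y + s%:R).
  by rewrite big_ord_recr /= bin_small // mulr0 mul0r addr0.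
rewrite /fdiff [LHS]big_ord_recl [in RHS]big_ord_recl -addrA -sumrB; congr (_ + _).
  by rewrite !bin0.
apply: eq_bigr => s _; rewrite !lift0 binS natrD exprS -natr1.
by rewrite -addrA [1 + _]addrC; ring.
Qed.

Lemma fdiffS_fun n f y : fdiff n.+1 f y = fdiff n (fun t => f t - f (t + 1)) y.
Proof.
rewrite fdiffS -fdiff_shift -mulN1r -fdiffZ -fdiffD.
by apply: eq_fdiff => s _; rewrite mulN1r.
Qed.

(** Each difference step lowers the Pochhammer length: (t)_(m+1) - (t+1)_(m+1) = - (m+1) (t+1)_m. *)
Lemma fdiff_poch n k y :
  fdiff n (poch (C := C) ^~ (n + k)%N) y
  = (-1) ^+ n * ((n + k) ^_ n)%:R * poch (y + n%:R) k.
Proof.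
elim: n y => [|n IHn] y; first by rewrite /fdiff big_ord1 !expr0 bin0 !mul1r.
have E (t : C) : poch t (n.+1 + k) - poch (t + 1) (n.+1 + k)
           = - (n + k).+1%:R * poch (t + 1) (n + k).
  by rewrite addSn (pochS (t + 1)) pochSl mulNr -natr1; ring.
rewrite fdiffS_fun (@eq_fdiff _ _ (fun t => - (n + k).+1%:R * poch (t + 1) (n + k))) //.
rewrite fdiffZ (fdiff_shift n (poch (C := C) ^~ (n + k)%N)) IHn.
by rewrite addSn ffactSS natrM exprS -addrA nat1r; ring.
Qed.

(** p(X) and p(X + 1) have the same leading coefficient, so one difference step lowers the
    degree. *)
Lemma fdiff_horner_eq0 n (p : {poly C}) y : (size p <= n)%N ->
  fdiff n (horner p) y = 0.
Proof.
elim: n p y => [|n IHn] p y.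
  rewrite leqn0 size_poly_eq0 => /eqP ->.
  by rewrite /fdiff big_ord1 horner0 mulr0.
move=> sp; rewrite fdiffS_fun.
rewrite (@eq_fdiff _ _ (horner (p - (p \Po ('X + 1%:P))))); last first.
  by move=> s _; rewrite hornerD hornerN horner_comp hornerD hornerX hornerC.
apply: IHn; apply/leq_sizeP => k; rewrite leq_eqVlt => /orP[/eqP <-|ltnk].
  have [ltp|lep] := ltnP (size p) n.+1.
    by rewrite coefB !nth_default ?subr0 ?size_comp_poly2 ?size_XaddC.
  have sE : n.+1 = size p by apply/eqP; rewrite eqn_leq lep sp.
  have nE : n = (size p).-1 by rewrite -sE.
  rewrite coefB nE -{2}(size_comp_poly2 p (size_XaddC (1 : C))) -!lead_coefE.
  by rewrite lead_coef_comp ?size_XaddC // lead_coefXaddC expr1n mulr1 subrr.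
by rewrite coefB !nth_default ?subr0 ?size_comp_poly2 ?size_XaddC // (leq_trans sp).
Qed.

Lemma fdiff_inv n y : poch y n.+1 != 0 ->
  fdiff n GRing.inv y = n`!%:R / poch y n.+1.
Proof.
elim: n y => [|n IHn] y; first by rewrite /fdiff /poch !big_ord1 bin0 !mul1r.
move=> yn0.
have E1 : poch y n.+2 = poch y n.+1 * (y + n.+1%:R) by rewrite pochS.
have E2 : poch y n.+2 = y * poch (y + 1) n.+1.
  by rewrite pochSl.
have := yn0; rewrite {1}E1 mulf_eq0 negb_or => /andP[y0 z0].
have := yn0; rewrite {1}E2 mulf_eq0 negb_or => /andP[w0 v0].
rewrite fdiffS !IHn // factS natrM.
(* Over the common denominator (y)_(n+2) the two terms leave (y + n + 1) - y = n + 1, the new factor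
   of the factorial. *)
have -> : poch y n.+1 = poch y n.+2 / (y + n.+1%:R) by rewrite E1 mulfK.
have -> : poch (y + 1) n.+1 = poch y n.+2 / y by rewrite E2 mulrC mulKf.
by field; rewrite yn0 w0 nat1r z0.
Qed.

(** p(t) / t = q(t) + p(0) / t with q of degree below n, and the difference kills q. *)
Lemma fdiff_horner_div n (p : {poly C}) y : (size p <= n.+1)%N -> poch y n.+1 != 0 ->
  fdiff n (fun t => p.[t] / t) y = p.[0] * n`!%:R / poch y n.+1.
Proof.
move=> sp y0; rewrite -mulrA -fdiff_inv // -fdiffZ.
have D0 : fdiff n (horner (drop_poly 1 p)) y = 0.
  by apply: fdiff_horner_eq0; rewrite size_drop_poly leq_subLR.
transitivity (fdiff n (fun t => (drop_poly 1 p).[t] + p.[0] * t^-1) y); last first.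
  by rewrite (fdiffD _ (horner _)) D0 add0r.
apply: eq_fdiff => s les.
have t0 : y + s%:R != 0.
  by move/prodf_neq0: y0 => /(_ (Ordinal (les : (s < n.+1)%N)) isT).
rewrite -{1 3}(poly_take_drop 1 p) !hornerD !hornerM !hornerX mulr0 addr0 mulrDl mulfK //.
by rewrite addrC (size1_polyC (size_take_poly 1 p)) !hornerC.
Qed.

Lemma fdiff_poch_div n c y : poch y n.+1 != 0 ->
  fdiff n (fun t => poch (t + c) n / t) y = poch c n * n`!%:R / poch y n.+1.
Proof.
move=> y0; pose p := \prod_(0 <= i < n) ('X - (- (c + i%:R))%:P).
have pE t : p.[t] = poch (t + c) n.
  rewrite horner_prod big_mkord; apply: eq_bigr => i _.
  by rewrite hornerXsubC opprK addrA.
rewrite -[poch c n](_ : p.[0] = _); last by rewrite pE add0r.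
rewrite -fdiff_horner_div //; last by rewrite size_prod_XsubC size_iota subn0.
by apply: eq_fdiff => s _; rewrite pE.
Qed.

(** * Orders of the three operators *)

Lemma diffop_orderP d (D : {poly {poly C}}) :
  (forall k, (d < k)%N -> D`_k = 0) -> D`_d != 0 -> diffop_order D d.
Proof.
move=> Dd D0; apply/eqP; rewrite eqn_leq; apply/andP; split; first exact/leq_sizeP.
by rewrite ltnNge; apply: contra D0 => /leq_sizeP ->.
Qed.

Lemma onesubX_neq0 : 1 - 'X != 0 :> {poly C}.
Proof. by rewrite -oppr_eq0 opprB polyXsubC_eq0. Qed.

Lemma order_pencil0 a beta : diffop_order (pencil0 a beta) 4.
Proof.
apply: diffop_orderP => [k le5k|]; rewrite /pencil0 /Lop /dz !(coefD, coefZ, coefXn).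
  by rewrite !gtn_eqF ?mulr0 ?addr0 // (leq_trans _ le5k).
rewrite /= mulr1 !mulr0 !addr0 expf_neq0 //.
by rewrite mulf_neq0 ?polyX_eq0 ?onesubX_neq0.
Qed.

Lemma order_pencil1 a beta : diffop_order (pencil1 a beta) 3.
Proof.
apply: diffop_orderP => [k le5k|]; rewrite /pencil1 /dz !(coefB, coefD, coefZ, coefXn).
  by rewrite !gtn_eqF ?mulr0 ?addr0 ?subr0 // (leq_trans _ le5k).
rewrite /= mulr1 !mulr0 !addr0 subr0 oppr_eq0 !mulf_neq0 ?polyX_eq0 ?onesubX_neq0 //.
by rewrite -polyC_natr polyC_eq0 pnatr_eq0.
Qed.

Lemma order_pencil2 a : diffop_order (pencil2 a) 2.
Proof.
apply: diffop_orderP => [k le5k|]; rewrite /pencil2 /dz !(coefB, coefZ, coefXn).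
  by rewrite !gtn_eqF ?mulr0 ?subr0 // (leq_trans _ le5k).
by rewrite /= mulr1 !mulr0 !subr0 mulf_neq0 // onesubX_neq0.
Qed.

(** * Coefficients of [lbp] and the differential equation *)

Definition coef2F1 a n s : C :=
  poch (- n%:R) s * poch (a + 1) s / (poch (a + 1 - n%:R) s * s`!%:R).

Definition lbp_scale a beta n : C :=
  poch (- a) n / poch (a + 1) n * ((a * n%:R + beta + n%:R) / (a * n%:R + beta)).

Lemma coef_lbp a beta n s (x := - ((a + 1) * n%:R) - beta) :
  (lbp a beta n)`_s = lbp_scale a beta n * (coef2F1 a n s * ((x + s%:R) / x)).
Proof.
rewrite /lbp coefZ coef_poly ltnS; case: leqP => // ltns.
by rewrite /coef2F1 poch_opp_nat ffact_small // !(mul0r, mulr0).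
Qed.

Lemma size_lbp_leq a beta n : (size (lbp a beta n) <= n.+1)%N.
Proof. by rewrite (leq_trans (size_scale_leq _ _)) // size_poly. Qed.

Lemma shift_nonint a (c : int) : (forall m : int, a != m%:~R) ->
  forall m : int, a + c%:~R != m%:~R.
Proof. by move=> aZ m; rewrite eq_sym -subr_eq eq_sym -intrB aZ. Qed.

Variable a : C.
Hypothesis aZ : forall m : int, a != m%:~R.

Lemma poch_shift_neq0 (c : int) n : poch (a + c%:~R) n != 0.
Proof. by apply: poch_neq0; apply: shift_nonint. Qed.

Let wE n : a + 1 - n%:R = a + (1 - n%:Z)%:~R.
Proof. by rewrite intrB addrA. Qed.

Let w0 n k : poch (a + 1 - n%:R) k != 0.
Proof. by rewrite wE poch_shift_neq0. Qed.

Lemma coef2F1S n s :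
  coef2F1 a n s.+1 * ((a - n%:R + s.+1%:R) * s.+1%:R)
  = coef2F1 a n s * ((s%:R - n%:R) * (a + s.+1%:R)).
Proof.
have := w0 n s.+1; rewrite pochS mulf_eq0 negb_or => /andP[ws wS].
rewrite /coef2F1 !pochS factS natrM -!natr1 in wS *.
field.
have fs : s`!%:R != 0 :> C by rewrite pnatr_eq0 -lt0n fact_gt0.
have S0 : s%:R + 1 != 0 :> C by rewrite natr1 pnatr_eq0.
by rewrite fs S0 ws wS.
Qed.

(** With w = a + 1 - n, splitting (w)_(n+s) in two ways trades (a+1)_s / (w)_s for (w+s)_n / (w)_n.
    What remains are the weights of [fdiff] times a polynomial in s. *)
Lemma coef2F1E n s :
  coef2F1 a n s = (-1) ^+ s * 'C(n, s)%:R *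
    (poch (a + 1 - n%:R + s%:R) n / poch (a + 1 - n%:R) n).
Proof.
have fs : s`!%:R != 0 :> C by rewrite pnatr_eq0 -lt0n fact_gt0.
have E : poch (a + 1 - n%:R) n * poch (a + 1) s
       = poch (a + 1 - n%:R) s * poch (a + 1 - n%:R + s%:R) n.
  by rewrite -pochD addnC pochD subrK.
rewrite /coef2F1 poch_opp_nat -bin_ffact natrM.
have -> : poch (a + 1) s =
    poch (a + 1 - n%:R) s * poch (a + 1 - n%:R + s%:R) n / poch (a + 1 - n%:R) n.
  by rewrite -E mulrAC mulfV ?mul1r.
by field; rewrite fs !w0.
Qed.

Lemma eigen_op_lbp beta n :
  diffop_apply (eigen_op (a - n%:R) beta n) (lbp a beta n) = 0.
Proof.
apply/polyP => m; rewrite coef0 coef_eigen_op_apply !coef_lbp.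
have := coef2F1S n m.+1; have := coef2F1S n m.
set x := _ - beta; set d0 := coef2F1 _ _ m; set d1 := coef2F1 _ _ m.+1.
set d2 := coef2F1 _ _ m.+2; set K := lbp_scale _ _ _ => E1 E2.
pose b := a - n%:R.
pose V1 : C := (m.+1%:R - n%:R) * (a + m.+2%:R).
(* [m.+1%:R * (b + m.+1%:R) * Bq] is the coefficient of [p`_m.+1] in
   [coef_eigen_op_apply]. *)
pose Bq : C := - 2 * (m.+1%:R ^+ 2 + b * m.+1%:R + 1 + beta).
(* The multiplier of the recurrence at m + 1 is forced by the coefficient of [d2], the one at m then
   by that of [d1]. Agreement at [d0] is an identity that relies on the values of [x] and
   [lambda]. *)
transitivity (K / x * (
   m.+1%:R * (b + m.+1%:R) * (x + m.+2%:R)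
     * (d2 * ((b + m.+2%:R) * m.+2%:R) - d1 * V1)
 + ((x + m.+2%:R) * V1 + Bq * (x + m.+1%:R))
     * (d1 * ((b + m.+1%:R) * m.+1%:R) - d0 * ((m%:R - n%:R) * (a + m.+1%:R))))).
  rewrite /V1 /Bq /b /x /lambda /xi1 /xi0 /eta1 /eta0 /zeta1 /zeta0 -!natr1.
  move: d0 d1 d2 {E1 E2} => d0 d1 d2.
  (* Both sides are linear in [x^-1], which stays opaque while [x] is expanded. *)
  rewrite -/x; set y := x^-1; rewrite /x; ring.
by rewrite /b E1 E2 !subrr !mulr0 addr0 mulr0.
Qed.

Lemma poch_reflect x n : poch (x + 1 - n%:R) n = (-1) ^+ n * poch (- x) n.
Proof.
elim: n => [|n IHn]; first by rewrite /poch !big_ord0 mul1r.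
rewrite pochSl pochS exprS -natr1.
have -> : x + 1 - (n%:R + 1) + 1 = x + 1 - n%:R by ring.
by rewrite IHn; ring.
Qed.

(** * Biorthogonality and normalization *)

Section Orthogonality.
Variables (beta : C) (n : nat).
Hypothesis beta0 : beta != 0.
Let x := - ((a + 1) * n%:R) - beta.
Hypothesis x0 : x != 0.

Lemma moment_lbp k : (k <= n)%N ->
  moment_functional (lbp_moment a beta) (lbp a beta n) (- k%:Z)
  = lbp_scale a beta n / (x * poch (a + 1 - n%:R) n) * (x - a + k%:R)
    * (poch (1 + k%:R - n%:R) n * n`!%:R / poch (a - k%:R) n.+1).
Proof.
move=> lekn; set w := a + 1 - n%:R.
have sz : moment_functional (lbp_moment a beta) (lbp a beta n) (- k%:Z)
  = \sum_(s < n.+1) (lbp a beta n)`_s * lbp_moment a beta (s%:Z - k%:Z).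
  rewrite /moment_functional.
  pose F (s : nat) := (lbp a beta n)`_s * lbp_moment a beta (s%:Z - k%:Z).
  rewrite (big_ord_widen n.+1 F) ?size_lbp_leq //.
  rewrite big_mkcond; apply: eq_bigr => s _.
  by case: ltnP => // les; rewrite nth_default // mul0r.
(* This shift makes w + s equal to t + c at t = a - k + s, the pole variable of the moment. *)
pose c := 1 + k%:R - n%:R : C.
have yE (s : nat) : w + s%:R = a - k%:R + s%:R + c by rewrite /w /c; ring.
have ak0 : poch (a - k%:R) n.+1 != 0.
  by rewrite -[k%:R]/(k%:~R) -mulrNz poch_shift_neq0.
pose K := lbp_scale a beta n / (x * poch w n).
(* With t = a - k + s, (x + s)(1 + beta / t) = (x + beta + s) + beta (x - a + k) / t. As x + beta +
   s = (w + s + n) - (a + 1)(n + 1), the first summand times (w+s)_n gives the two Pochhammer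
   terms. *)
transitivity (K / beta * (fdiff n (fun t => poch t n.+1 - (a + 1) * n.+1%:R * poch t n) w
   + beta * (x - a + k%:R) * fdiff n (fun t => poch (t + c) n / t) (a - k%:R))).
  rewrite sz /fdiff [beta * _ * _]big_distrr -big_split /= big_distrr /=.
  apply: eq_bigr => s _; rewrite coef_lbp coef2F1E -/w -/x -yE pochS /lbp_moment.
  have t0 : a - k%:R + s%:R != 0.
    by move/prodf_neq0: ak0 => /(_ s isT).
  have w1 : poch w n != 0 by apply: w0.
  have -> : (s%:Z - k%:Z)%:~R = s%:R - k%:R :> C by rewrite intrB.
  have t1 : s%:R - k%:R + a != 0 by rewrite addrC addrA addrAC.
  rewrite /K -natr1 /x /w; move: (poch w n) w1 (poch (w + _) n) => u u0 v.
  by field; rewrite t0 beta0 u0 x0.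
rewrite fdiff_poch_div // -/c.
suff -> : fdiff n (fun t => poch t n.+1 - (a + 1) * n.+1%:R * poch t n) w = 0.
  by rewrite add0r /K; field; rewrite ak0 x0 beta0 w0.

(* Since w + n = a + 1, both terms equal (-1)^n (n+1)! (a + 1) and cancel. *)
have F1 := fdiff_poch n 1 w; have F0 := fdiff_poch n 0 w.
rewrite addn1 in F1; rewrite addn0 in F0.
transitivity (fdiff n (fun t => poch t n.+1 + - ((a + 1) * n.+1%:R) * poch t n) w).
  by apply: eq_fdiff => s _; rewrite mulNr.
rewrite (fdiffD _ (fun t => poch t n.+1)) (fdiffZ _ _ (fun t => poch t n)) F1 F0.
rewrite ffactnn ffact_factd // subSnn divn1 factS natrM /poch big_ord0 big_ord1 /w /=.
ring.
Qed.

(** By reflection (a+1-n)_n = (-1)^n (-a)_n, and (x + n) / x = (an + beta) / (an + beta + n);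
    [lbp_scale] is exactly the inverse of the resulting coefficient. *)
Lemma lead_coef_lbp : a * n%:R + beta != 0 -> (lbp a beta n)`_n = 1.
Proof.
move=> an0; rewrite coef_lbp -/x /coef2F1 poch_opp_nat ffactnn poch_reflect /lbp_scale.
have a1 : poch (a + 1) n != 0 by apply: (poch_shift_neq0 1).
have a0 : poch (- a) n != 0.
  by have := w0 n n; rewrite poch_reflect mulf_eq0 signr_eq0.
have fn : n`!%:R != 0 :> C by rewrite pnatr_eq0 -lt0n fact_gt0.
have -> : x + n%:R = - (a * n%:R + beta) by rewrite /x; ring.
have -> : a * n%:R + beta + n%:R = - x by rewrite /x; ring.
move: x x0 an0 (poch _ n) a1 (poch _ n) a0 (n`!%:R : C) fn => y y0 an0 p p0 q q0 f f0.
by field; rewrite y0 f0 q0 signr_eq0 an0 p0.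
Qed.

End Orthogonality.

Lemma monic_LBP_lbp beta : beta != 0 ->
  (forall n, (1 <= n)%N -> beta + n%:R * a != 0) ->
  (forall n, (1 <= n)%N -> beta + n%:R * (a + 1) != 0) ->
  monic_LBP (lbp_moment a beta) (lbp a beta).
Proof.
move=> b0 bna bna1 n.
have an0 : a * n%:R + beta != 0.
  by case: n => [|n]; [rewrite mulr0 add0r | rewrite addrC mulrC bna].
have an1 : a * n%:R + beta + n%:R != 0.
  case: n {an0} => [|n]; first by rewrite mulr0 add0r addr0.
  by have := bna1 n.+1 isT; congr (_ != 0); ring.
have x0 : - ((a + 1) * n%:R) - beta != 0.
  by rewrite -oppr_eq0; move: an1; congr (_ != 0); ring.
have lc := lead_coef_lbp x0 an0.
have sz : size (lbp a beta n) = n.+1.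
  apply/eqP; rewrite eqn_leq size_lbp_leq ltnNge; apply/negP => le.
  by move/eqP: lc; rewrite nth_default // eq_sym oner_eq0.
split=> //.
- by rewrite monicE lead_coefE sz lc.
- move=> k ltkn; rewrite moment_lbp //; last exact: ltnW.
  (* For k < n the base is -(n-1-k), so one of the n factors vanishes. *)
  suff -> : poch (1 + k%:R - n%:R) n = 0 :> C by rewrite !(mul0r, mulr0).
  rewrite nat1r -opprB -natrB // poch_opp_nat ffact_small ?mulr0 //.
  by rewrite subnS prednK ?leq_subr ?subn_gt0.
rewrite moment_lbp // addrK.
have a1 : poch (a + 1) n != 0 by apply: (poch_shift_neq0 1).
have a0 : poch (- a) n != 0.
  by have := w0 n n; rewrite poch_reflect mulf_eq0 signr_eq0.
have ak0 : poch (a - n%:R) n.+1 != 0.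
  by rewrite -[n%:R]/(n%:~R) -mulrNz poch_shift_neq0.
have fn : n`!%:R != 0 :> C by rewrite pnatr_eq0 -lt0n fact_gt0.
have p1 : poch 1 n != 0 :> C.
  by apply/prodf_neq0 => i _; rewrite nat1r pnatr_eq0.
(* At k = n this factor is -(beta + (n + 1) a), whence the hypothesis at n + 1. *)
have xa : - ((a + 1) * n%:R) - beta - a + n%:R != 0.
  by rewrite -oppr_eq0; have := bna n.+1 isT; congr (_ != 0); rewrite -natr1; ring.
by rewrite /lbp_scale !(mulf_neq0, invr_neq0).
Qed.

End LaurentBiorthogonal.

Theorem mainTheorem8 (R : realType) (alpha beta : R[i]) (j : int)
    (a : R[i]) (def_a : a = alpha + j%:~R)
    (alpha_notint : forall m : int, alpha != m%:~R)
    (beta_neq0 : beta != 0)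
    (beta_na : forall n : nat, (1 <= n)%N -> beta + n%:R * a != 0)
    (beta_na1 : forall n : nat, (1 <= n)%N -> beta + n%:R * (a + 1) != 0) :
  monic_LBP (lbp_moment a beta) (lbp a beta) /\
  exists L0 L1 L2 : {poly {poly R[i]}},
    [/\ diffop_order L0 4, diffop_order L1 3 & diffop_order L2 2] /\
    forall n : nat,
      L2 *+ (n ^ 2)%N + L1 *+ n + L0 = eigen_op (a - n%:R) beta n /\
      diffop_apply (L2 *+ (n ^ 2)%N + L1 *+ n + L0) (lbp a beta n) = 0.
Proof.
have aZ (m : int) : a != m%:~R by rewrite def_a shift_nonint.
split; first exact: monic_LBP_lbp.
exists (pencil0 a beta), (pencil1 a beta), (pencil2 a); split.
  by split; [exact: order_pencil0 | exact: order_pencil1 | exact: order_pencil2].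
by move=> n; rewrite eigen_op_pencil eigen_op_lbp.
Qed.
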